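(* Let $\mathcal{A}$ and $\mathcal{B}$ be finite structures over the same signature. The following are equivalent: (i) for every sentence $\varphi$ of $\{\exists,\forall,\wedge,\vee\}\text{-FO}$, if $\mathcal{A}\models\varphi$ then $\mathcal{B}\models\varphi$; (ii) there exists a surjective hyper-morphism from $\mathcal{A}$ to $\mathcal{B}$; (iii) $\mathcal{B}\models\theta_{\mathcal{A},|B|}$.
   Context: Structures are finite relational structures with nonempty domain; $A,B$ are the domains. $\{\exists,\forall,\wedge,\vee\}\text{-FO}$ is the set of first-order sentences built from relational atoms (no equality, no negation) using $\wedge,\vee,\exists,\forall$. A surjective hyper-morphism from $\mathcal{A}$ to $\mathcal{B}$ is a map $f$ from $A$ to the power set of $B$ such that $f(a)\ne\emptyset$ for all $a\in A$, $\bigcup_{a\in A}f(a)=B$, and for every relation symbol $R$ of arity $i$, $R(a_1,\dots,a_i)$ in $\mathcal{A}$ implies $R(b_1,\dots,b_i)$ in $\mathcal{B}$ for all $b_j\in f(a_j)$. For a tuple $\mathbf{s}=(s_1,\dots,s_l)\in A^l$, $\phi_{\mathcal{A}(\mathbf{s})}(z_1,\dots,z_l)$ is the conjunction of all atoms $R(z_{\lambda_1},\dots,z_{\lambda_i})$ such that $R(s_{\lambda_1},\dots,s_{\lambda_i})$ holds in $\mathcal{A}$. Let $\mathbf{r}=(r_1,\dots,r_{|A|})$ be an enumeration of $A$. For $m>0$, $\theta_{\mathcal{A},m}:=\exists v_1\dots v_{|A|}\,\big(\phi_{\mathcal{A}(\mathbf{r})}(v_1,\dots,v_{|A|})\wedge\forall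 w_1\dots w_m\bigvee_{\mathbf{t}\in A^m}\phi_{\mathcal{A}(\mathbf{r},\mathbf{t})}(v_1,\dots,v_{|A|},w_1,\dots,w_m)\big)$, where in $\phi_{\mathcal{A}(\mathbf{r},\mathbf{t})}$ the variables $v_1,\dots,v_{|A|},w_1,\dots,w_m$ correspond to the entries of $(\mathbf{r},\mathbf{t})$. *)

(* Defs.v *)
From mathcomp Require Import all_boot.
Set Implicit Arguments.
Unset Strict Implicit.
Unset Printing Implicit Defensive.

(* The set of symbols is finite, so that phi and theta below are formulas.    *)
Record signature := Signature {
  symbol : finType;
  arity : symbol -> nat }.

Record structure (S : signature) := Structure {
  domain :> finType;
  domain_gt0 : 0 < #|{: domain}|;
  interp : forall R : symbol S, (arity R).-tuple domain -> bool }.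

(* Variables are natural numbers. Verum and Falsum do not belong to the       *)
(* fragment {exists, forall, and, or}-FO (see in_fragment): they only stand   *)
(* for the empty conjunction and the empty disjunction.                       *)
Inductive formula (S : signature) : Type :=
| Verum
| Falsum
| Atom (R : symbol S) (x : (arity R).-tuple nat)
| And (f g : formula S)
| Or (f g : formula S)
| Ex (x : nat) (f : formula S)
| All (x : nat) (f : formula S).

Arguments Verum {S}.
Arguments Falsum {S}.
Arguments Atom {S} R x.

Section Semantics.
Variable S : signature.
Implicit Types (A B : structure S) (f g : formula S).

Fixpoint in_fragment f : bool :=
  match f with
  | Verum | Falsum => false
  | Atom _ _ => true
  | And f g | Or f g => in_fragment f && in_fragment g
  | Ex _ f | All _ f => in_fragment f
  end.

Fixpoint free_vars f : seq nat :=
  match f with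
  | Verum | Falsum => [::]
  | Atom _ x => x
  | And f g | Or f g => free_vars f ++ free_vars g
  | Ex x f | All x f => [seq y <- free_vars f | y != x]
  end.

Definition sentence f : bool := free_vars f == [::].

Definition update A (e : nat -> A) (x : nat) (a : A) : nat -> A :=
  fun y => if y == x then a else e y.

Fixpoint sat A (e : nat -> A) f : Prop :=
  match f with
  | Verum => True
  | Falsum => False
  | Atom R x => interp (map_tuple e x)
  | And f g => sat e f /\ sat e g
  | Or f g => sat e f \/ sat e g
  | Ex x f => exists a : A, sat (update e x a) f
  | All x f => forall a : A, sat (update e x a) f
  end.

(* Used for sentences only, whose truth value does not depend on e.           *)
Definition models A f : Prop := forall e : nat -> A, sat e f.

Record surj_hyper_morphism A B (h : A -> {set B}) : Prop := SurjHyperMorphism {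
  shm_total : forall a : A, h a != set0;
  shm_surj : \bigcup_(a : A) h a = [set: B];
  shm_rel : forall (R : symbol S) (a : (arity R).-tuple A)
                   (b : (arity R).-tuple B),
    interp a -> (forall j, tnth b j \in h (tnth a j)) -> interp b }.

(* No unit is appended to a nonempty conjunction or disjunction, which thus   *)
(* stays in the fragment when its members do.                                 *)
Fixpoint conj_seq (s : seq (formula S)) : formula S :=
  match s with
  | [::] => Verum
  | [:: f] => f
  | f :: s' => And f (conj_seq s')
  end.

Fixpoint disj_seq (s : seq (formula S)) : formula S :=
  match s with
  | [::] => Falsum
  | [:: f] => f
  | f :: s' => Or f (disj_seq s')
  end.

Definition exists_vars (xs : seq nat) f : formula S := foldr (@Ex S) f xs.
Definition forall_vars (xs : seq nat) f : formula S := foldr (@All S) f xs.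

(* p ranges over the pairs (R, lambda) of a symbol and a tuple of positions   *)
(* lambda in {0, ..., l-1}^(arity R).                                         *)
Definition phi A (l : nat) (s : l.-tuple A) (z : l.-tuple nat) : formula S :=
  conj_seq [seq Atom (tag p) (map_tuple (tnth z) (tagged p))
       | p <- enum {: {R : symbol S & (arity R).-tuple 'I_l}}
       & interp (map_tuple (tnth s) (tagged p))].

(* v_1, ..., v_|A| are the variables 0, ..., |A|-1 and w_1, ..., w_m are      *)
(* |A|, ..., |A|+m-1.                                                         *)
Definition theta A (r : #|{: A}|.-tuple A) (m : nat) : formula S :=
  let v := [tuple val i | i < #|{: A}|] in
  let w := [tuple #|{: A}| + val j | j < m] in
  exists_vars v
    (And (phi r v)
         (forall_vars w
            (disj_seq [seq phi (cat_tuple r t) (cat_tuple v w)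
                  | t <- enum {: m.-tuple A}]))).

End Semantics.

(* Main.v *)
(* Surjective hyper-morphisms preserve satisfaction of all formulas under
   related valuations, and A satisfies theta_{A,m} for every m; so (ii) implies
   (i) and (iii). Conversely, let B satisfy theta_{A,|B|}, with v the witnesses
   in B of the enumeration r, and let w enumerate B: some disjunct, given by t,
   holds, and a |-> {(v,w)_k | (r,t)_k = a} is a surjective hyper-morphism,
   total because r enumerates A, onto because w enumerates B. Finally (i) gives
   (iii) as soon as some relation of A is nonempty, which is what puts
   theta_{A,m} in the fragment; otherwise a |-> B is a hyper-morphism. *)
Require Import Defs.
From mathcomp Require Import all_boot.
Set Implicit Arguments.
Unset Strict Implicit.
Unset Printing Implicit Defensive.

(** * Satisfaction of iterated connectives and quantifiers *)

Section Formulas.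
Variable S : signature.
Implicit Types (A B : structure S) (f : formula S) (xs : seq nat).

(** Valuations are functions: updates that agree pointwise need not be provably equal, so
    satisfaction has to be transported along [=1]. *)
Lemma sat_eq A (e e' : nat -> A) f : e =1 e' -> sat e f -> sat e' f.
Proof.
have updE (d d' : nat -> A) x a : d =1 d' -> update d x a =1 update d' x a.
  by move=> dd' y; rewrite /update dd'.
elim: f e e' => [||R x|f IHf g IHg|f IHf g IHg|x f IH|x f IH] e e' ee' //=.
- suff -> : map_tuple e x = map_tuple e' x by [].
  by apply/val_inj/eq_map.
- by case=> /(IHf _ _ ee') ? /(IHg _ _ ee').
- by case=> [/(IHf _ _ ee')|/(IHg _ _ ee')]; [left|right].
- by case=> a sat_a; exists a; apply: IH sat_a; apply: updE.
- by move=> sat_f a; apply: IH (sat_f a); apply: updE.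
Qed.

Lemma sat_conj_seq A (e : nat -> A) (T : eqType) (F : T -> formula S) s :
  sat e (conj_seq (map F s)) <-> {in s, forall x, sat e (F x)}.
Proof.
elim: s => [|x [|y s] IH]; first by split.
  by split=> [? z|]; [rewrite inE => /eqP-> | apply; rewrite inE].
split=> [[sat_x /IH sat_s] z|sat_s].
  by rewrite inE => /predU1P[->|/sat_s].
split; first by apply: sat_s; rewrite mem_head.
by apply/IH => z sz; apply: sat_s; rewrite inE sz orbT.
Qed.

Lemma sat_disj_seq A (e : nat -> A) (T : eqType) (F : T -> formula S) s :
  sat e (disj_seq (map F s)) <-> exists2 x, x \in s & sat e (F x).
Proof.
elim: s => [|x [|y s] IH]; first by split=> [|[]].
  by split=> [|[z]]; [exists x; rewrite ?inE | rewrite inE => /eqP->].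
split=> [[sat_x|/IH[z sz sat_z]]|[z]].
- by exists x; rewrite ?mem_head.
- by exists z; rewrite // inE sz orbT.
- rewrite inE => /predU1P[->|sz sat_z]; first by left.
  by right; apply/IH; exists z.
Qed.

(** Successive updates compose to a single valuation, which stands for the tuple of witnesses; a
    repeated variable is governed by its innermost quantifier. *)
Lemma sat_exists_vars A (e : nat -> A) xs f :
  sat e (exists_vars xs f) <->
  exists2 e' : nat -> A, (forall y, y \notin xs -> e' y = e y) & sat e' f.
Proof.
elim: xs e => [|x xs IH] e.
  split=> [|[e' e'E]]; first by exists e.
  by apply: sat_eq => y; apply: e'E.
split=> [[a /IH[e' e'E sat_f]]|[e' e'E sat_f]].
  exists e' => // y; rewrite inE negb_or => /andP[/negPf yx /e'E->].
  by rewrite /update yx.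
exists (e' x); apply/IH; exists e' => // y yxs.
by rewrite /update; case: eqVneq => [->//|yx]; rewrite e'E // inE negb_or yx.
Qed.

Lemma sat_forall_vars A (e : nat -> A) xs f :
  sat e (forall_vars xs f) <->
  forall e' : nat -> A, (forall y, y \notin xs -> e' y = e y) -> sat e' f.
Proof.
elim: xs e => [|x xs IH] e.
  split=> [sat_f e' e'E|]; last by apply.
  by apply: sat_eq sat_f => y; rewrite e'E.
split=> [sat_f e' e'E|sat_f a].
  have /IH := sat_f (e' x); apply=> y yxs; rewrite /update.
  by case: eqVneq => [->//|yx]; rewrite e'E // inE negb_or yx.
apply/IH => e' e'E; apply: sat_f => y.
by rewrite inE negb_or => /andP[/negPf yx /e'E->]; rewrite /update yx.
Qed.

Lemma sat_phi A B (e : nat -> B) l (s : l.-tuple A) (z : l.-tuple nat) :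
  sat e (phi s z) <->
  forall (R : symbol S) (lam : (arity R).-tuple 'I_l),
    interp (map_tuple (tnth s) lam) ->
    interp (map_tuple e (map_tuple (tnth z) lam)).
Proof.
split=> [/sat_conj_seq sat_s R lam s_lam|sat_s].
  by apply: (sat_s (Tagged _ lam)); rewrite mem_filter mem_enum andbT.
by apply/sat_conj_seq => -[R lam]; rewrite mem_filter => /andP[/sat_s].
Qed.

(** When [e] reads [z] as [s], the conjuncts become exactly facts of [A]. *)
Lemma sat_phi_self A l (e : nat -> A) (s : l.-tuple A) (z : l.-tuple nat) :
  (forall k, e (tnth z k) = tnth s k) -> sat e (phi s z).
Proof.
move=> ez; apply/sat_phi => R lam.
suff -> : map_tuple (tnth s) lam = map_tuple e (map_tuple (tnth z) lam) by [].
by apply: eq_from_tnth => j; rewrite !tnth_map ez.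
Qed.

(** * Free variables *)

Lemma free_vars_conj_seq (T : eqType) (F : T -> formula S) s (P : pred nat) :
  {in s, forall x, all P (free_vars (F x))} ->
  all P (free_vars (conj_seq (map F s))).
Proof.
elim: s => [|x [|y s] IH] // Fs; first by apply: Fs; rewrite inE.
rewrite [free_vars _]/= all_cat Fs ?mem_head //=.
by apply: IH => z sz; apply: Fs; rewrite inE sz orbT.
Qed.

Lemma free_vars_disj_seq (T : eqType) (F : T -> formula S) s (P : pred nat) :
  {in s, forall x, all P (free_vars (F x))} ->
  all P (free_vars (disj_seq (map F s))).
Proof.
elim: s => [|x [|y s] IH] // Fs; first by apply: Fs; rewrite inE.
rewrite [free_vars _]/= all_cat Fs ?mem_head //=.
by apply: IH => z sz; apply: Fs; rewrite inE sz orbT.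
Qed.

Lemma free_vars_exists_vars xs f :
  free_vars (exists_vars xs f) = [seq y <- free_vars f | y \notin xs].
Proof.
elim: xs => [|x xs /= ->]; first by rewrite filter_predT.
by rewrite -filter_predI; apply: eq_filter => y; rewrite !inE negb_or.
Qed.

Lemma free_vars_forall_vars xs f :
  free_vars (forall_vars xs f) = [seq y <- free_vars f | y \notin xs].
Proof.
elim: xs => [|x xs /= ->]; first by rewrite filter_predT.
by rewrite -filter_predI; apply: eq_filter => y; rewrite !inE negb_or.
Qed.

Lemma free_vars_phi A l (s : l.-tuple A) (z : l.-tuple nat) :
  {subset free_vars (phi s z) <= z}.
Proof.
apply/allP; apply: free_vars_conj_seq => -[R lam] _ /=.
by apply/allP => _ /mapP[k _ ->]; apply: mem_tnth.
Qed.

(** * Membership in the fragment *)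

(** The element [x] makes the sequence nonempty, so that the conjunction is not [Verum], which lies
    outside the fragment. *)
Lemma in_fragment_conj_seq (T : eqType) (F : T -> formula S) s x :
  x \in s -> {in s, forall y, in_fragment (F y)} ->
  in_fragment (conj_seq (map F s)).
Proof.
elim: s x => [//|x [|y s] IH] _ _ Fs; first by apply: Fs; rewrite inE.
rewrite [in_fragment _]/= Fs ?mem_head //=.
by apply: (IH y); rewrite ?mem_head // => z sz; apply: Fs; rewrite inE sz orbT.
Qed.

Lemma in_fragment_disj_seq (T : eqType) (F : T -> formula S) s x :
  x \in s -> {in s, forall y, in_fragment (F y)} ->
  in_fragment (disj_seq (map F s)).
Proof.
elim: s x => [//|x [|y s] IH] _ _ Fs; first by apply: Fs; rewrite inE.
rewrite [in_fragment _]/= Fs ?mem_head //=.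
by apply: (IH y); rewrite ?mem_head // => z sz; apply: Fs; rewrite inE sz orbT.
Qed.

Lemma in_fragment_exists_vars xs f :
  in_fragment (exists_vars xs f) = in_fragment f.
Proof. by elim: xs. Qed.

Lemma in_fragment_forall_vars xs f :
  in_fragment (forall_vars xs f) = in_fragment f.
Proof. by elim: xs. Qed.

(** A fact of [A] whose entries occur in [s] contributes a conjunct, so the conjunction is
    nonempty. *)
Lemma in_fragment_phi A l (s : l.-tuple A) (z : l.-tuple nat)
    (R : symbol S) (a : (arity R).-tuple A) :
  {subset a <= s} -> interp a -> in_fragment (phi s z).
Proof.
move=> sas ia.
have /fin_all_exists[lam lamE] j : exists k, tnth s k = tnth a j.
  by have /tnthP[k ->] := sas _ (mem_tnth j a); exists k.
apply: (@in_fragment_conj_seq _ _ _ (Tagged _ [tuple lam j | j < arity R])) => //.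
rewrite mem_filter mem_enum andbT /=.
suff -> : map_tuple (tnth s) [tuple lam j | j < arity R] = a by [].
by apply: eq_from_tnth => j; rewrite tnth_map tnth_mktuple.
Qed.

(** * Preservation by surjective hyper-morphisms *)

(** Induction on [f]: [shm_rel] handles atoms, totality carries a witness of [Ex] into [B], and
    surjectivity pulls an instance of [All] back to [A]. *)
Lemma sat_hyper_morphism A B (h : A -> {set B}) (e : nat -> A) (e' : nat -> B) f :
  surj_hyper_morphism h -> (forall x, e' x \in h (e x)) -> sat e f -> sat e' f.
Proof.
case=> h_tot h_surj h_rel.
have updE (d : nat -> A) (d' : nat -> B) x a b : b \in h a ->
    (forall y, d' y \in h (d y)) ->
    forall y, update d' x b y \in h (update d x a y).
  by move=> hab dd' y; rewrite /update; case: ifP.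
elim: f e e' => [||R x|f IHf g IHg|f IHf g IHg|x f IH|x f IH] e e' ee' //=.
- by move=> /h_rel; apply=> j; rewrite !tnth_map.
- by case=> /(IHf _ _ ee') ? /(IHg _ _ ee').
- by case=> [/(IHf _ _ ee')|/(IHg _ _ ee')]; [left|right].
- case=> a sat_a; have /set0Pn[b hab] := h_tot a.
  by exists b; apply: IH sat_a; apply: updE.
- move=> sat_f b; have: b \in \bigcup_(a : A) h a by rewrite h_surj inE.
  by case/bigcupP=> a _ hab; apply: IH (sat_f a); apply: updE.
Qed.

Lemma models_hyper_morphism A B (h : A -> {set B}) f :
  surj_hyper_morphism h -> models A f -> models B f.
Proof.
move=> hh Af e'.
have preim b : exists a, b \in h a.
  have: b \in \bigcup_(a : A) h a by rewrite (shm_surj hh) inE.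
  by case/bigcupP=> a _ hab; exists a.
(* By surjectivity, [e'] is related to a valuation in [A] that chooses a preimage of each value. *)
apply: (sat_hyper_morphism hh _ (Af (fun x => xchoose (preim (e' x))))).
by move=> x; apply: (xchooseP (preim (e' x))).
Qed.

End Formulas.

(** * The sentence [theta]: truth in [A], closedness, membership in the fragment *)

Section Theta.
Variables (S : signature) (A : structure S) (r : #|{: A}|.-tuple A) (m : nat).

Let v := [tuple val i | i < #|{: A}|].
Let w := [tuple #|{: A}| + val j | j < m].

Let notin_v y : y \notin v -> #|{: A}| <= y.
Proof.
apply: contraR; rewrite -ltnNge => yn; apply/tnthP.
by exists (Ordinal yn); rewrite tnth_mktuple.
Qed.

Let w_ge y : y \in w -> #|{: A}| <= y.
Proof. by case/tnthP=> j ->; rewrite tnth_mktuple leq_addr. Qed.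

Lemma models_theta_self : models A (theta r m).
Proof.
move=> e; apply/sat_exists_vars.
(* Variable [i] takes the value [r_i]; the default [e y] leaves all variables outside [v]
   unchanged. *)
exists (fun y => nth (e y) r y).
  by move=> y /notin_v ny; rewrite nth_default ?size_tuple.
have rE y (i : 'I_#|{: A}|) : nth y r i = tnth r i by rewrite -tnth_nth.
split; first by apply: sat_phi_self => k; rewrite tnth_mktuple rE.
apply/sat_forall_vars => e' e'E; apply/sat_disj_seq.
(* The disjunct to choose is given by the values of [w] themselves. *)
exists [tuple e' (#|{: A}| + val j) | j < m]; first by rewrite mem_enum.
apply: sat_phi_self => k; case: (split_ordP k) => j ->.
  rewrite !tnth_lshift tnth_mktuple e'E ?rE //.
  by apply/negP => /w_ge; rewrite leqNgt ltn_ord.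
by rewrite !tnth_rshift !tnth_mktuple.
Qed.

Lemma sentence_theta : sentence (theta r m).
Proof.
(* It remains to see that every free variable of the body belongs to [v]. *)
rewrite /sentence free_vars_exists_vars -size_eq0 size_filter eqn0Ngt.
rewrite -has_count -all_predC /= all_cat free_vars_forall_vars.
apply/andP; split; apply/allP => y /=; rewrite negbK.
  exact: free_vars_phi.
rewrite mem_filter => /andP[yw yF].
have: y \in cat_tuple v w.
  apply: (allP _ y yF); apply: free_vars_disj_seq => t _.
  by apply/allP => z; apply: free_vars_phi.
by rewrite mem_cat (negPf yw) orbF.
Qed.

Hypothesis r_full : forall a, a \in r.

Lemma in_fragment_theta (R : symbol S) (a : (arity R).-tuple A) :
  interp a -> in_fragment (theta r m).
Proof.
move=> ia; rewrite in_fragment_exists_vars /= in_fragment_forall_vars.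
rewrite (in_fragment_phi _ _ ia) => [|x _]; last exact: r_full.
have /card_gt0P[a0 _] := domain_gt0 A.
(* The constant tuple shows that the disjunction is nonempty, hence not [Falsum]. *)
apply: (@in_fragment_disj_seq _ _ _ _ [tuple a0 | _ < m]).
  by rewrite mem_enum.
by move=> t _; apply: in_fragment_phi ia => x _; rewrite mem_cat r_full.
Qed.

End Theta.

(** * Extraction of a hyper-morphism from [theta], and the equivalences *)

Lemma theta_hyper_morphism (S : signature) (A B : structure S)
    (r : #|{: A}|.-tuple A) (e : nat -> B) :
  (forall a, a \in r) -> sat e (theta r #|{: B}|) ->
  exists h : A -> {set B}, surj_hyper_morphism h.
Proof.
move=> r_full /sat_exists_vars[e1 _ [_ /sat_forall_vars sat_w]].
set n := #|{: A}| in r r_full sat_w; set m := #|{: B}| in sat_w.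
(* [e2] keeps the witnesses for [v] and sends the [w] variable [n + j] to the [j]-th element of [B];
   the default [e1 y] ensures agreement with [e1] from [n + m] on. *)
pose e2 y := if y < n then e1 y else nth (e1 y) (enum {: B}) (y - n).
have /sat_w/sat_disj_seq[t _ /sat_phi sat_t] y :
    y \notin [tuple n + val j | j < m] -> e2 y = e1 y.
  move=> yw; rewrite /e2; case: ltnP => // ny.
  rewrite nth_default // -cardE; apply: contraR yw; rewrite -ltnNge => ym.
  by apply/tnthP; exists (Ordinal ym); rewrite tnth_mktuple /= subnKC.
set s := cat_tuple r t in sat_t; set z := cat_tuple _ _ in sat_t.
exists (fun a => [set b | [exists k, (tnth s k == a) && (e2 (tnth z k) == b)]]).
split.
- move=> a; have /tnthP[i ra] := r_full a; apply/set0Pn.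
  exists (e2 (tnth z (lshift m i))); rewrite inE; apply/existsP.
  by exists (lshift m i); rewrite tnth_lshift ra !eqxx.
- apply/setP => b; rewrite inE; apply/bigcupP.
  (* The position of the [w] variable whose value is [b]. *)
  pose k := rshift n (enum_rank b).
  exists (tnth s k) => //; rewrite inE; apply/existsP; exists k.
  rewrite eqxx tnth_rshift tnth_mktuple /e2 ltnNge leq_addr /= addKn.
  by rewrite nth_enum_rank eqxx.
- move=> R a b ia hab.
  (* A position is chosen for each argument, carrying [a_j] in [s] and [b_j] under [z]; the fact
     [R(a)] then makes the atom at these positions a conjunct of the true disjunct. *)
  have /fin_all_exists2[lam lam_a lam_b] j :
      exists2 k, tnth s k = tnth a j & e2 (tnth z k) = tnth b j.
    by have := hab j; rewrite inE => /existsP[k /andP[/eqP ? /eqP ?]]; exists k.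
  have aE : map_tuple (tnth s) [tuple lam j | j < arity R] = a.
    by apply: eq_from_tnth => j; rewrite tnth_map tnth_mktuple.
  have := sat_t R [tuple lam j | j < arity R]; rewrite aE => /(_ ia).
  congr (is_true (interp _)).
  by apply: eq_from_tnth => j; rewrite !tnth_map tnth_ord_tuple.
Qed.

Theorem theorem2 (S : signature) (A B : structure S)
  (r : #|{: A}|.-tuple A) (r_enum : perm_eq r (enum {: A})) :
  ((forall f : formula S, in_fragment f -> sentence f ->
      models A f -> models B f)
   <-> (exists h : A -> {set B}, surj_hyper_morphism h))
  /\
  ((exists h : A -> {set B}, surj_hyper_morphism h)
   <-> models B (theta r #|{: B}|)).
Proof.
have r_full a : a \in r by rewrite (perm_mem r_enum) mem_enum.
have /card_gt0P[a0 _] := domain_gt0 A.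
have /card_gt0P[b0 _] := domain_gt0 B.
have theta_h : models B (theta r #|{: B}|) ->
    exists h : A -> {set B}, surj_hyper_morphism h.
  (* [models] quantifies over valuations, so one is needed to instantiate it; a constant one exists
     since [B] is nonempty. *)
  by move=> /(_ (fun=> b0)); apply: theta_hyper_morphism.
split; split=> //.
- move=> AB.
  case: (pickP (fun p : {R : symbol S & (arity R).-tuple A} =>
                  interp (tagged p))) => [[R a] ia|A_empty].
    apply: theta_h; apply: AB; last exact: models_theta_self.
      exact: (in_fragment_theta _ r_full ia).
    exact: sentence_theta.
  (* All relations of [A] are empty here: preservation is vacuous, [b0] gives totality, and [a0]
     gives surjectivity. *)
  exists (fun=> [set: B]); split=> [a||R a b ia _].
  + by apply/set0Pn; exists b0; rewrite inE.
  + by apply/setP => b; rewrite inE; apply/bigcupP; exists a0; rewrite ?inE.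
  + by have := A_empty (Tagged _ a); rewrite /= ia.
- by case=> h hh f _ _; apply: models_hyper_morphism hh.
- by case=> h hh; apply: (models_hyper_morphism hh); apply: models_theta_self.
Qed.
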